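(* Let $\mathcal{X}$, $\mathcal{Y}$ and $\mathcal{T}$ be compactly generated triangulated categories in which bounded projective objects are bounded, i.e. $\mathcal{X}^{\mathsf{b}}_p\subseteq\mathcal{X}^{\mathsf{b}}$, $\mathcal{Y}^{\mathsf{b}}_p\subseteq\mathcal{Y}^{\mathsf{b}}$ and $\mathcal{T}^{\mathsf{b}}_p\subseteq\mathcal{T}^{\mathsf{b}}$. \begin{enumerate} \item[(i)] If there is a recollement $(\mathcal{X}^{\mathsf{b}},\mathcal{T}^{\mathsf{b}},\mathcal{Y}^{\mathsf{b}})$, then $\mathcal{T}$ has finite global dimension if and only if both $\mathcal{X}$ and $\mathcal{Y}$ have finite global dimension. \item[(ii)] If there is a recollement $(\mathcal{X},\mathcal{T},\mathcal{Y})$ and $\mathcal{X}$ and $\mathcal{Y}$ have finite global dimension, then $\mathcal{T}$ has finite global dimension. \end{enumerate}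
   Context: For a triangulated category $\mathcal{D}$, $\mathcal{D}^{\mathsf{c}}$ is its subcategory of compact objects; $\mathcal{D}$ is compactly generated if it has coproducts, $\mathcal{D}^{\mathsf{c}}$ is skeletally small and $\mathrm{Hom}_{\mathcal{D}}(c,y)=0$ for all $c\in\mathcal{D}^{\mathsf{c}}$ implies $y=0$. $\mathcal{D}^{\mathsf{b}}$ (bounded objects) is the subcategory of those $t$ such that for every $c\in\mathcal{D}^{\mathsf{c}}$, $\mathrm{Hom}_{\mathcal{D}}(c,t[n])=0$ for all but finitely many $n\in\mathbb{Z}$. $\mathcal{D}^{\mathsf{b}}_p$ (bounded projective objects) is the subcategory of those $t$ such that for every $x\in\mathcal{D}^{\mathsf{b}}$, $\mathrm{Hom}_{\mathcal{D}}(t,x[n])=0$ for all but finitely many $n\in\mathbb{Z}$. $\mathcal{D}$ has finite global dimension if $\mathcal{D}^{\mathsf{b}}_p=\mathcal{D}^{\mathsf{b}}$. A recollement $(\mathcal{A},\mathcal{B},\mathcal{C})$ of triangulated categories consists of triangle functors $\mathsf{i}\colon\mathcal{A}\to\mathcal{B}$, $\mathsf{q},\mathsf{p}\colon\mathcal{B}\to\mathcal{A}$, $\mathsf{e}\colon\mathcal{B}\to\mathcal{C}$, $\mathsf{l},\mathsf{r}\colon\mathcal{C}\to\mathcal{B}$ such that $(\mathsf{q},\mathsf{i},\mathsf{p})$ and $(\mathsf{l},\mathsf{e},\mathsf{r})$ are adjoint triples, $\mathsf{i}$, $\mathsf{l}$, $\mathsf{r}$ are fully faithful and $\mathrm{Ker}(\mathsf{e})=\mathrm{Im}(\mathsf{i})$.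 *)

(* Defs.v *)
From mathcomp Require Import all_boot all_order all_algebra.

Set Implicit Arguments.
Unset Strict Implicit.
Unset Printing Implicit Defensive.

Import GRing.Theory.
Local Open Scope ring_scope.

(* "Sets": the fixed universe that contains the carriers of all Hom groups.
   Objects of a category may live in a larger universe, so that categories with
   coproducts indexed by all small types are not forced to be degenerate. *)
Definition small := Type@{Algebra.Zmodule.axioms_.u0}.

Reserved Notation "g ∘ f" (at level 40, left associativity).

Record preadditive := Preadditive {
  obj :> Type;
  mor : obj -> obj -> zmodType;
  idm : forall x, mor x x;
  mcomp : forall x y z, mor y z -> mor x y -> mor x z;
  mcompA : forall w x y z (h : mor y z) (g : mor x y) (f : mor w x),
    mcomp h (mcomp g f) = mcomp (mcomp h g) f;
  comp1m : forall x y (f : mor x y), mcomp (idm y) f = f;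
  compm1 : forall x y (f : mor x y), mcomp f (idm x) = f;
  compDl : forall x y z (g g' : mor y z) (f : mor x y),
    mcomp (g + g') f = mcomp g f + mcomp g' f;
  compDr : forall x y z (g : mor y z) (f f' : mor x y),
    mcomp g (f + f') = mcomp g f + mcomp g f' }.

Arguments mor {p} x y.
Arguments idm {p} x.
Arguments mcomp {p x y z} g f.
Notation "g ∘ f" := (mcomp g f) : ring_scope.

Section Preadditive.
Variable C : preadditive.
Implicit Types x y z : C.

Definition hom_trivial x y := forall f : mor x y, f = 0.

Definition is_zero x := (forall y, hom_trivial x y) /\ (forall y, hom_trivial y x).

Definition is_biproduct x y s (i1 : mor x s) (i2 : mor y s)
    (p1 : mor s x) (p2 : mor s y) :=
  [/\ p1 ∘ i1 = idm x, p2 ∘ i2 = idm y, p2 ∘ i1 = 0, p1 ∘ i2 = 0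
    & i1 ∘ p1 + i2 ∘ p2 = idm s].

Definition is_iso x y (f : mor x y) :=
  exists g : mor y x, g ∘ f = idm x /\ f ∘ g = idm y.

Definition isomorphic x y := exists f : mor x y, is_iso f.

Definition is_coproduct (I : small) (x : I -> C) (s : C)
    (inj : forall i, mor (x i) s) :=
  forall y (f : forall i, mor (x i) y),
    exists! g : mor s y, forall i, g ∘ inj i = f i.

Definition has_coproducts :=
  forall (I : small) (x : I -> C),
    exists (s : C) (inj : forall i, mor (x i) s), is_coproduct inj.

(* Hom(c, -) preserves coproducts: whenever s is a coproduct of the x i, the
   group Hom(c, s) is a coproduct of the Hom(c, x i) in abelian groups. *)
Definition compact (c : C) :=
  forall (I : small) (x : I -> C) (s : C) (inj : forall i, mor (x i) s),
    is_coproduct inj ->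
    forall (V : zmodType) (phi : forall i, {additive mor c (x i) -> V}),
      exists psi : {additive mor c s -> V},
        (forall i (f : mor c (x i)), psi (inj i ∘ f) = phi i f) /\
        (forall psi' : {additive mor c s -> V},
           (forall i (f : mor c (x i)), psi' (inj i ∘ f) = phi i f) ->
           psi' =1 psi).

Definition skeletally_small (P : C -> Prop) :=
  exists (S : small) (k : S -> C),
    forall x, P x -> exists s, isomorphic x (k s).

End Preadditive.

Record functor (C D : preadditive) := Functor {
  fobj :> C -> D;
  fmap : forall x y : C, mor x y -> mor (fobj x) (fobj y);
  fmap1 : forall x : C, fmap (idm x) = idm (fobj x);
  fmap_comp : forall (x y z : C) (g : mor y z) (f : mor x y),
    fmap (g ∘ f) = fmap g ∘ fmap f;
  fmapD : forall (x y : C) (f g : mor x y), fmap (f + g) = fmap f + fmap g }.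

Arguments fmap {C D} F {x y} f : rename.

Definition functor_id (C : preadditive) : functor C C :=
  @Functor C C (fun x => x) (fun x y f => f) (fun x => erefl)
    (fun x y z g f => erefl) (fun x y f g => erefl).

Definition functor_comp (C D E : preadditive) (G : functor D E)
    (F : functor C D) : functor C E.
Proof.
exists (fun x => G (F x)) (fun x y f => fmap G (fmap F f)).
- by move=> x; rewrite !fmap1.
- by move=> x y z g f; rewrite !fmap_comp.
- by move=> x y f g; rewrite !fmapD.
Defined.

Definition functor_pow (C : preadditive) (F : functor C C) (n : nat) :
  functor C C := iter n (functor_comp F) (functor_id C).

Record nat_iso (C D : preadditive) (F G : functor C D) := NatIso {
  niso :> forall x : C, mor (F x) (G x);
  niso_inv : forall x : C, mor (G x) (F x);
  niso_natural : forall (x y : C) (f : mor x y),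
    niso y ∘ fmap F f = fmap G f ∘ niso x;
  nisoK : forall x, niso_inv x ∘ niso x = idm (F x);
  niso_invK : forall x, niso x ∘ niso_inv x = idm (G x) }.

Record adjunction (C D : preadditive) (F : functor C D) (G : functor D C) :=
  Adjunction {
  adj : forall (x : C) (y : D), mor (F x) y -> mor x (G y);
  adj_bij : forall (x : C) (y : D), bijective (@adj x y);
  adj_natural : forall (x x' : C) (y y' : D) (u : mor x' x) (v : mor y y')
      (f : mor (F x) y),
    adj (v ∘ f ∘ fmap F u) = fmap G v ∘ adj f ∘ u }.

Definition fully_faithful (C D : preadditive) (F : functor C D) :=
  forall x y : C, bijective (fun f : mor x y => fmap F f).

(* The suspension is an autoequivalence with a chosen quasi-inverse, so that
   negative shifts make sense; strict automorphisms are a special case. *)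
Record triangulated := Triangulated {
  tcat :> preadditive;
  has_zero : exists z : tcat, is_zero z;
  has_biproducts : forall x y : tcat, exists (s : tcat) (i1 : mor x s)
    (i2 : mor y s) (p1 : mor s x) (p2 : mor s y), is_biproduct i1 i2 p1 p2;
  susp : functor tcat tcat;
  desusp : functor tcat tcat;
  suspK : nat_iso (functor_comp desusp susp) (functor_id tcat);
  desuspK : nat_iso (functor_comp susp desusp) (functor_id tcat);
  distinguished : forall x y z : tcat,
    mor x y -> mor y z -> mor z (susp x) -> Prop;
  tr_iso : forall (x y z x' y' z' : tcat)
      (f : mor x y) (g : mor y z) (h : mor z (susp x))
      (f' : mor x' y') (g' : mor y' z') (h' : mor z' (susp x'))
      (a : mor x x') (b : mor y y') (c : mor z z'),
    is_iso a -> is_iso b -> is_iso c ->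
    b ∘ f = f' ∘ a -> c ∘ g = g' ∘ b -> fmap susp a ∘ h = h' ∘ c ->
    distinguished f g h -> distinguished f' g' h';
  tr_id : forall x z : tcat, is_zero z ->
    distinguished (idm x) (0 : mor x z) (0 : mor z (susp x));
  tr_cone : forall (x y : tcat) (f : mor x y),
    exists (z : tcat) (g : mor y z) (h : mor z (susp x)), distinguished f g h;
  tr_rotate : forall (x y z : tcat)
      (f : mor x y) (g : mor y z) (h : mor z (susp x)),
    distinguished f g h <-> distinguished g h (- fmap susp f);
  tr_map : forall (x y z x' y' z' : tcat)
      (f : mor x y) (g : mor y z) (h : mor z (susp x))
      (f' : mor x' y') (g' : mor y' z') (h' : mor z' (susp x'))
      (a : mor x x') (b : mor y y'),
    distinguished f g h -> distinguished f' g' h' -> b ∘ f = f' ∘ a ->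
    exists c : mor z z', c ∘ g = g' ∘ b /\ fmap susp a ∘ h = h' ∘ c;
  tr_octahedron : forall (x y z x' y' z' : tcat)
      (f : mor x y) (f' : mor y z') (f'' : mor z' (susp x))
      (g : mor y z) (g' : mor z x') (g'' : mor x' (susp y))
      (h' : mor z y') (h'' : mor y' (susp x)),
    distinguished f f' f'' -> distinguished g g' g'' ->
    distinguished (g ∘ f) h' h'' ->
    exists (u : mor z' y') (v : mor y' x'),
      [/\ distinguished u v (fmap susp f' ∘ g''),
          u ∘ f' = h' ∘ g, h'' ∘ u = f'',
          v ∘ h' = g' & g'' ∘ v = fmap susp f ∘ h''] }.

Arguments susp {t}.
Arguments desusp {t}.
Arguments suspK {t}.
Arguments desuspK {t}.
Arguments distinguished {t x y z} f g h.

(* shift n x is the object x[n]. *)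
Definition shift (T : triangulated) (n : int) : functor T T :=
  match n with
  | Posz k => functor_pow susp k
  | Negz k => functor_pow desusp k.+1
  end.

Record triangle_functor (S T : triangulated) := TriangleFunctor {
  tfunctor :> functor S T;
  tfunctor_susp : nat_iso (functor_comp tfunctor susp)
                          (functor_comp susp tfunctor);
  tfunctor_distinguished : forall (x y z : S)
      (f : mor x y) (g : mor y z) (h : mor z (susp x)),
    distinguished f g h ->
    distinguished (fmap tfunctor f) (fmap tfunctor g)
                  (tfunctor_susp x ∘ fmap tfunctor h) }.

Record recollement (A B C : triangulated) := Recollement {
  rec_i : triangle_functor A B;
  rec_q : triangle_functor B A;
  rec_p : triangle_functor B A;
  rec_e : triangle_functor B C;
  rec_l : triangle_functor C B;
  rec_r : triangle_functor C B;
  rec_adj_qi : adjunction rec_q rec_i;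
  rec_adj_ip : adjunction rec_i rec_p;
  rec_adj_le : adjunction rec_l rec_e;
  rec_adj_er : adjunction rec_e rec_r;
  rec_i_ff : fully_faithful rec_i;
  rec_l_ff : fully_faithful rec_l;
  rec_r_ff : fully_faithful rec_r;
  rec_ker_im : forall b : B,
    is_zero (rec_e b) <-> exists a : A, isomorphic (rec_i a) b }.

Section Boundedness.
Variable T : triangulated.
Implicit Types c t x y : T.

Definition compactly_generated :=
  [/\ has_coproducts T, skeletally_small (@compact T)
    & forall y, (forall c, compact c -> hom_trivial c y) -> is_zero y].

(* Hom(x, y[n]) = 0 for all but finitely many n. *)
Definition finitely_many_homs x y :=
  exists s : seq int, forall n : int, n \notin s -> hom_trivial x (shift T n y).

Definition bounded t := forall c, compact c -> finitely_many_homs c t.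

Definition bounded_projective t :=
  forall x, bounded x -> finitely_many_homs t x.

Definition finite_gldim := forall t, bounded_projective t <-> bounded t.

End Boundedness.

Section FullSubcategory.

Record triangulated_subcategory (T : triangulated) (P : T -> Prop) : Prop :=
  TriangulatedSubcategory {
  sub_zero : forall x, is_zero x -> P x;
  sub_biproduct : forall x y s (i1 : mor x s) (i2 : mor y s)
      (p1 : mor s x) (p2 : mor s y),
    is_biproduct i1 i2 p1 p2 -> P x -> P y -> P s;
  sub_susp : forall x, P x -> P (susp x);
  sub_desusp : forall x, P x -> P (desusp x);
  sub_cone : forall x y z (f : mor x y) (g : mor y z) (h : mor z (susp x)),
    distinguished f g h -> P x -> P y -> P z }.

Definition full_preadditive (C : preadditive) (P : C -> Prop) : preadditive :=
  @Preadditive {x : C | P x} (fun x y => mor (sval x) (sval y))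
    (fun x => idm (sval x)) (fun x y z g f => g ∘ f)
    (fun w x y z => @mcompA C _ _ _ _) (fun x y => @comp1m C _ _)
    (fun x y => @compm1 C _ _) (fun x y z => @compDl C _ _ _)
    (fun x y z => @compDr C _ _ _).

Definition full_functor (C : preadditive) (P : C -> Prop) (F : functor C C)
    (PF : forall x, P x -> P (F x)) :
    functor (full_preadditive P) (full_preadditive P) :=
  @Functor (full_preadditive P) (full_preadditive P)
    (fun x => exist _ (F (sval x)) (PF _ (svalP x)))
    (fun x y f => fmap F f) (fun x => @fmap1 _ _ F _)
    (fun x y z => @fmap_comp _ _ F _ _ _) (fun x y => @fmapD _ _ F _ _).

Variables (T : triangulated) (P : T -> Prop) (HP : triangulated_subcategory P).
Let S := full_preadditive P.

Lemma full_is_zero (x : S) : is_zero x -> is_zero (sval x).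
Proof.
case=> H _; have id0 : idm (sval x) = 0 by exact: (H x (idm x)).
split=> y f; [rewrite -(compm1 f) id0|rewrite -(comp1m f) id0].
  by apply: (addrI (f ∘ 0)); rewrite -compDr !addr0.
by apply: (addrI (0 ∘ f)); rewrite -compDl !addr0.
Qed.

Lemma full_is_iso (x y : S) (f : mor x y) :
  is_iso f -> is_iso (f : @mor T (sval x) (sval y)).
Proof. by case=> g; exists g. Qed.

Definition full_triangulated : triangulated.
Proof.
refine (@Triangulated S _ _ (full_functor (sub_susp HP))
  (full_functor (sub_desusp HP)) _ _
  (fun x y z f g h => @distinguished T (sval x) (sval y) (sval z) f g h)
  _ _ _ _ _ _).
- have [z zz] := has_zero T; exists (exist _ z (sub_zero HP zz)).
  by split=> y f; [exact: zz.1|exact: zz.2].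
- move=> x y.
  have [s [i1 [i2 [p1 [p2 b]]]]] := has_biproducts (sval x) (sval y).
  have Ps := sub_biproduct HP b (svalP x) (svalP y).
  by exists (exist _ s Ps), i1, i2, p1, p2.
- refine (@NatIso S S (functor_comp (full_functor (sub_desusp HP))
    (full_functor (sub_susp HP))) (functor_id S) (fun x => suspK (sval x))
    (fun x => niso_inv suspK (sval x)) _ _ _) => /=.
  + by move=> x y f; exact: (niso_natural suspK).
  + by move=> x; exact: (nisoK suspK).
  + by move=> x; exact: (niso_invK suspK).
- refine (@NatIso S S (functor_comp (full_functor (sub_susp HP))
    (full_functor (sub_desusp HP))) (functor_id S) (fun x => desuspK (sval x))
    (fun x => niso_inv desuspK (sval x)) _ _ _) => /=.
  + by move=> x y f; exact: (niso_natural desuspK).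
  + by move=> x; exact: (nisoK desuspK).
  + by move=> x; exact: (niso_invK desuspK).
- move=> x y z x' y' z' f g h f' g' h' a b c /full_is_iso ia /full_is_iso ib
    /full_is_iso ic; exact: tr_iso.
- move=> x z /full_is_zero; exact: tr_id.
- move=> x y f; have [z [g [h d]]] := tr_cone (f : @mor T _ _).
  by exists (exist _ z (sub_cone HP d (svalP x) (svalP y))), g, h.
- by move=> x y z f g h; exact: (@tr_rotate T).
- by move=> x y z x' y' z' f g h f' g' h' a b; exact: (@tr_map T).
- by move=> x y z x' y' z' f f' f'' g g' g'' h' h''; exact: (@tr_octahedron T).
Defined.

End FullSubcategory.

Section BoundedSubcategory.

Section Preadditive.
Variable C : preadditive.

Lemma comp0m (x y z : C) (f : mor x y) : (0 : mor y z) ∘ f = 0.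
Proof. by apply: (addrI (0 ∘ f)); rewrite -compDl !addr0. Qed.

Lemma compm0 (x y z : C) (g : mor y z) : g ∘ (0 : mor x y) = 0.
Proof. by apply: (addrI (g ∘ 0)); rewrite -compDr !addr0. Qed.

Lemma compNm (x y z : C) (g : mor y z) (f : mor x y) : (- g) ∘ f = - (g ∘ f).
Proof. by apply: (addrI (g ∘ f)); rewrite -compDl !subrr comp0m. Qed.

Lemma compmN (x y z : C) (g : mor y z) (f : mor x y) : g ∘ (- f) = - (g ∘ f).
Proof. by apply: (addrI (g ∘ f)); rewrite -compDr !subrr compm0. Qed.

Lemma fmap0 (D : preadditive) (F : functor C D) (x y : C) :
  fmap F (0 : mor x y) = 0.
Proof. by apply: (addrI (fmap F 0)); rewrite -fmapD !addr0. Qed.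

Lemma hom_trivial_iso (c x y : C) :
  isomorphic x y -> hom_trivial c x -> hom_trivial c y.
Proof.
case=> u [v [_ uv]] H f.
by rewrite -(comp1m f) -uv -mcompA (H (v ∘ f)) compm0.
Qed.

Lemma isomorphic_refl (x : C) : isomorphic x x.
Proof. by exists (idm x), (idm x); rewrite comp1m. Qed.

Lemma isomorphic_sym (x y : C) : isomorphic x y -> isomorphic y x.
Proof. by case=> f [g [gf fg]]; exists g, f. Qed.

Lemma isomorphic_functor (D : preadditive) (F : functor C D) (x y : C) :
  isomorphic x y -> isomorphic (F x) (F y).
Proof.
case=> f [g [gf fg]]; exists (fmap F f), (fmap F g).
by rewrite -!fmap_comp gf fg !fmap1.
Qed.

Lemma isomorphic_niso (D : preadditive) (F G : functor C D) (a : nat_iso F G)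
  (x : C) : isomorphic (F x) (G x).
Proof. by exists (a x), (niso_inv a x); rewrite nisoK niso_invK. Qed.

Lemma functor_powS (F : functor C C) n x :
  functor_pow F n (F x) = functor_pow F n.+1 x.
Proof. by elim: n => //= n; rewrite /functor_pow /= => ->. Qed.

(* Exactness of Hom(c, x) -> Hom(c, y) -> Hom(c, z) at the middle term, for
   all c. *)
Definition hom_exact (x y z : C) (f : mor x y) (g : mor y z) :=
  forall c (u : mor c y), g ∘ u = 0 -> exists v : mor c x, u = f ∘ v.

Variables (F G : functor C C).
Variables (GF : nat_iso (functor_comp G F) (functor_id C)).

Lemma niso_fmapE x y (f : mor x y) :
  f = GF y ∘ fmap G (fmap F f) ∘ niso_inv GF x.
Proof.
have e : GF y ∘ fmap G (fmap F f) = f ∘ GF x := niso_natural GF f.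
have k : GF x ∘ niso_inv GF x = idm x := niso_invK GF x.
by rewrite e -(mcompA f) k compm1.
Qed.

Lemma fmap_equiv_inj x y (f g : mor x y) : fmap F f = fmap F g -> f = g.
Proof. by move=> e; rewrite (niso_fmapE f) e -niso_fmapE. Qed.

End Preadditive.

Section Equivalence.
Variables (C : preadditive) (F G : functor C C).
Variables (GF : nat_iso (functor_comp G F) (functor_id C)).
Variables (FG : nat_iso (functor_comp F G) (functor_id C)).

Lemma fmap_equiv_full x y (w : mor (F x) (F y)) :
  exists v : mor x y, w = fmap F v.
Proof.
exists (GF y ∘ fmap G w ∘ niso_inv GF x).
apply: (fmap_equiv_inj FG); set v := _ ∘ _ ∘ _.
have := niso_fmapE GF v; rewrite {1}/v => /(congr1 (fun k => niso_inv GF y ∘ k ∘ GF x)).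
by rewrite !mcompA nisoK !comp1m -!mcompA nisoK !compm1.
Qed.

Lemma hom_exact_equiv x y z (f : mor x y) (g : mor y z) :
  hom_exact f g -> hom_exact (fmap F f) (fmap F g).
Proof.
move=> ex c u gu0.
have [u' eu'] := fmap_equiv_full (u ∘ FG c).
have gu'0 : g ∘ u' = 0.
  by apply: (fmap_equiv_inj GF); rewrite fmap_comp -eu' mcompA gu0 comp0m fmap0.
have [v ev] := ex _ _ gu'0.
exists (fmap F v ∘ niso_inv FG c).
have k : FG c ∘ niso_inv FG c = idm c := niso_invK FG c.
by rewrite mcompA -fmap_comp -ev -eu' -(mcompA u) k compm1.
Qed.

End Equivalence.

Section Triangulated.
Variable T : triangulated.

Lemma distinguished_exact (x y z : T) (f : mor x y) (g : mor y z)
  (h : mor z (susp x)) : distinguished f g h -> hom_exact g h.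
Proof.
move=> d c u hu0; have [o oo] := has_zero T.
have /tr_rotate d1 := tr_id c oo.
have /tr_rotate/tr_rotate d2 := d.
have e : (0 : mor o (susp x)) ∘ (0 : mor c o) = h ∘ u by rewrite hu0 comp0m.
have [w [_]] := tr_map d1 d2 e.
rewrite compmN compNm fmap1 compm1 => /oppr_inj.
have [v ->] := fmap_equiv_full suspK desuspK w.
by rewrite -fmap_comp => /(fmap_equiv_inj suspK) ->; exists v.
Qed.

Lemma hom_exact_shift n (x y z : T) (f : mor x y) (g : mor y z) :
  hom_exact f g -> hom_exact (fmap (shift T n) f) (fmap (shift T n) g).
Proof.
have pow (F : functor T T) k :
    (forall x y z (f : mor x y) (g : mor y z),
       hom_exact f g -> hom_exact (fmap F f) (fmap F g)) ->
    hom_exact f g ->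
    hom_exact (fmap (functor_pow F k) f) (fmap (functor_pow F k) g).
  by move=> HF ex; elim: k => //= k IH; exact: HF.
case: n => n; [apply: (pow susp n)|apply: (pow desusp n.+1)] => x' y' z' f' g'.
  exact: (hom_exact_equiv suspK desuspK).
exact: (hom_exact_equiv desuspK suspK).
Qed.

Lemma shift_susp n (x : T) : isomorphic (shift T n (susp x)) (shift T (n + 1) x).
Proof.
case: n => [n|[|n]].
- have -> : Posz n + 1 = Posz n.+1 by rewrite -addn1 PoszD.
  by rewrite /shift functor_powS; exact: isomorphic_refl.
- exact: (isomorphic_niso suspK).
- have -> : Negz n.+1 + 1 = Negz n by rewrite !NegzE -addn1 PoszD opprD addrNK.
  change (isomorphic (functor_pow desusp n.+2 (susp x))
    (functor_pow desusp n.+1 x)).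
  rewrite -functor_powS.
  exact/isomorphic_functor/(isomorphic_niso suspK).
Qed.

Lemma shift_desusp n (x : T) :
  isomorphic (shift T n (desusp x)) (shift T (n - 1) x).
Proof.
case: n => [[|n]|n].
- exact: isomorphic_refl.
- have -> : Posz n.+1 - 1 = Posz n by rewrite -addn1 PoszD addrK.
  rewrite /shift -functor_powS.
  exact/isomorphic_functor/(isomorphic_niso desuspK).
- have -> : Negz n - 1 = Negz n.+1 by rewrite !NegzE -opprD -PoszD addn1.
  by rewrite /shift functor_powS; exact: isomorphic_refl.
Qed.

Lemma finitely_many_homs_susp (c x : T) :
  finitely_many_homs c x -> finitely_many_homs c (susp x).
Proof.
case=> s Hs; exists (map (fun n => n - 1) s) => n ns.
apply: (hom_trivial_iso (isomorphic_sym (shift_susp n x))); apply: Hs.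
by apply: contra ns => ns; apply/mapP; exists (n + 1); rewrite ?addrK.
Qed.

Lemma finitely_many_homs_desusp (c x : T) :
  finitely_many_homs c x -> finitely_many_homs c (desusp x).
Proof.
case=> s Hs; exists (map (fun n => n + 1) s) => n ns.
apply: (hom_trivial_iso (isomorphic_sym (shift_desusp n x))); apply: Hs.
by apply: contra ns => ns; apply/mapP; exists (n - 1); rewrite ?subrK.
Qed.

Lemma bounded_subcategory : triangulated_subcategory (@bounded T).
Proof.
split.
- move=> x xx c _; exists [::] => n _ f.
  have id0 : idm x = 0 by exact: xx.1.
  by rewrite -(comp1m f) -(fmap1 (shift T n)) id0 fmap0 comp0m.
- move=> x y s i1 i2 p1 p2 [_ _ _ _ ids] bx by_ c cc.
  have [sx Hx] := bx c cc; have [sy Hy] := by_ c cc.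
  exists (sx ++ sy) => n; rewrite mem_cat negb_or => /andP[nx ny] f.
  rewrite -(comp1m f) -(fmap1 (shift T n)) -ids fmapD !fmap_comp compDl.
  by rewrite -!mcompA (Hx _ nx (_ ∘ f)) (Hy _ ny (_ ∘ f)) !compm0 addr0.
- by move=> x bx c cc; exact/finitely_many_homs_susp/bx.
- by move=> x bx c cc; exact/finitely_many_homs_desusp/bx.
- move=> x y z f g h d bx by_ c cc.
  have [sx Hx] := finitely_many_homs_susp (bx c cc).
  have [sy Hy] := by_ c cc.
  exists (sx ++ sy) => n; rewrite mem_cat negb_or => /andP[nx ny] u.
  have [|v ->] := @hom_exact_shift n _ _ _ _ _ (distinguished_exact d) c u.
    exact: Hx.
  by rewrite (Hy _ ny v) compm0.
Qed.

(* The full triangulated subcategory of bounded objects. *)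
Definition bounded_category : triangulated :=
  full_triangulated bounded_subcategory.

End Triangulated.
End BoundedSubcategory.

(* Main.v *)
From HB Require Import structures.
From mathcomp Require Import all_boot all_order all_algebra.
From mathcomp Require Import boolp.
Require Import Defs.

Set Implicit Arguments.
Unset Strict Implicit.
Unset Printing Implicit Defensive.

Import GRing.Theory.
Local Open Scope ring_scope.

(** The argument rests on the canonical triangle [l e t -> t -> i a] of a
    recollement, where moreover [a] is isomorphic to [q t] ([rec_triangle],
    [rec_triangle_q]). By adjunction, [Hom(l e t, t'[n])] is [Hom(e t, e t'[n])]
    and [Hom(i a, t'[n])] is [Hom(a, (p t')[n])], so finiteness of graded Hom
    groups out of [t] follows from finiteness in the two outer categories.

    When bounded projective objects are bounded, finite global dimension says
    that any two bounded objects have only finitely many nonzero graded Hom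
    groups. For a recollement of the categories of bounded objects, (i) is then
    immediate: one direction is the triangle, the other one is the full
    faithfulness of [i] and [l].

    For (ii), let [t] and [t'] be bounded. One has to know that [e t] and [e t']
    are bounded in [Y], and that [a] and [p t'] are bounded in [X]. The functors
    [l] and [q] preserve compact objects, since their right adjoints preserve
    coproducts; hence [e] and [i] preserve bounded objects. As [Y] has finite
    global dimension, [l e t] is bounded projective, hence bounded, and so is
    [i a]; thus [Hom(q d, a[n])] vanishes for almost all [n] if [d] is compact.
    The same vanishing for [p t'] comes from the canonical triangle of [d]: the
    object [d] is bounded projective, hence bounded, and so the first step
    applies to [Hom(e d, e t'[n])].

    It remains to see that boundedness in [X] may be tested on the objects [q d]
    only, although [X] has more compact objects ([bounded_generators]). Let [S]
    be a generating set of compact objects, closed under shifts, and let [x] be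
    such that each [s] in [S] has only finitely many nonzero maps to shifts of
    [x]. Then the coproduct [W] of all [x[n]] behaves like a product as seen from
    [S]: for [z] in [S], every family of maps [z -> x[n]] comes from a unique map
    [z -> W]. Existence and uniqueness of lifts pass to coproducts of objects of
    [S], and existence then passes to extensions by the four lemma. For a compact object [c], attach coproducts of objects of [S] repeatedly to kill
    all maps from [S]; the composite of this sequence of cones starting at [c]
    vanishes after finitely many steps ([ghost_telescope]), so that [susp c] is a
    direct summand of an iterated extension of suspended coproducts of objects of
    [S], and has the lifting property too. Now choose, for each [n], a nonzero
    map [susp c -> x[n]] if there is one. The resulting map [susp c -> W] has only
    finitely many nonzero components because [susp c] is compact. *)

(** * Preadditive categories *)

Section PreadditiveLemmas.
Variable C : preadditive.
Implicit Types x y z c : C.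

Lemma isomorphic_trans x y z : isomorphic x y -> isomorphic y z -> isomorphic x z.
Proof.
case=> f [f' [f'f ff']] [g [g' [g'g gg']]]; exists (g ∘ f), (f' ∘ g'); split.
  by rewrite mcompA -(mcompA f') g'g compm1.
by rewrite mcompA -(mcompA g) ff' compm1.
Qed.

Lemma hom_trivial_isol x x' y :
  isomorphic x x' -> hom_trivial x y -> hom_trivial x' y.
Proof.
case=> u [v [_ uv]] H f.
by rewrite -(compm1 f) -uv mcompA (H (f ∘ u)) comp0m.
Qed.

Lemma hom_trivial_id x : hom_trivial x x -> is_zero x.
Proof.
move=> /(_ (idm x)) id0; split=> y f; first by rewrite -(compm1 f) id0 compm0.
by rewrite -(comp1m f) id0 comp0m.
Qed.

Lemma compBm x y z (g g' : mor y z) (f : mor x y) :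
  (g - g') ∘ f = g ∘ f - g' ∘ f.
Proof. by rewrite compDl compNm. Qed.

Lemma compmB x y z (g : mor y z) (f f' : mor x y) :
  g ∘ (f - f') = g ∘ f - g ∘ f'.
Proof. by rewrite compDr compmN. Qed.

Lemma fmapN (D : preadditive) (F : functor C D) x y (f : mor x y) :
  fmap F (- f) = - fmap F f.
Proof. by apply: (addrI (fmap F f)); rewrite -fmapD !subrr fmap0. Qed.

Lemma comp_sumr (I : Type) (r : seq I) x y z (g : mor y z) (f : I -> mor x y) :
  g ∘ (\sum_(i <- r) f i) = \sum_(i <- r) (g ∘ f i).
Proof.
by elim: r => [|i r IH]; rewrite ?big_nil ?compm0 // !big_cons compDr IH.
Qed.

(** Post-composition with a fixed morphism, as a homomorphism of abelian
    groups. *)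
Definition postcomp x y z (g : mor y z) (f : mor x y) := g ∘ f.

Lemma postcomp_is_zmod_morphism x y z (g : mor y z) :
  zmod_morphism (@postcomp x y z g).
Proof. by move=> f f'; exact: compmB. Qed.

HB.instance Definition _ x y z (g : mor y z) :=
  GRing.isZmodMorphism.Build _ _ (@postcomp x y z g)
    (postcomp_is_zmod_morphism g).

(** ** Coproducts and compact objects *)

Section Coproduct.
Variables (I : small) (x : I -> C) (s : C) (inj : forall i, mor (x i) s).
Hypothesis cop : is_coproduct inj.

Lemma coproduct_ex y (f : forall i, mor (x i) y) :
  exists g : mor s y, forall i, g ∘ inj i = f i.
Proof. by have [g [Hg _]] := cop f; exists g. Qed.

Lemma coproduct_ext y (f g : mor s y) :
  (forall i, f ∘ inj i = g ∘ inj i) -> f = g.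
Proof.
move=> e; have [h [_ Hh]] := cop (fun i => g ∘ inj i).
by rewrite -(Hh f e) -(Hh g).
Qed.

(** The projections to the summands, available because of zero morphisms. *)
Lemma coproduct_proj : exists p : forall i, mor s (x i),
  (forall i, p i ∘ inj i = idm (x i)) /\
  (forall i j, i <> j -> p i ∘ inj j = 0).
Proof.
suff H i : exists p : mor s (x i),
    p ∘ inj i = idm (x i) /\ forall j, i <> j -> p ∘ inj j = 0.
  exists (fun i => projT1 (cid (H i))); split=> i; case: cid => /= p [] //.
pose d j : mor (x j) (x i) :=
  if pselect (j = i) is left e then ecast k (mor (x j) (x k)) e (idm (x j))
  else 0.
have [p Hp] := coproduct_ex d; exists p; split=> [|j ij]; rewrite Hp /d.
  by case: pselect => // e; rewrite (Prop_irrelevance e erefl).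
by case: pselect => // e; case: ij.
Qed.

Variables (c : C) (cc : compact c).

(** Additive maps out of [mor c s] are determined on the summands. *)
Lemma compact_ext (V : zmodType) (f g : {additive mor c s -> V}) :
  (forall i (u : mor c (x i)), f (inj i ∘ u) = g (inj i ∘ u)) -> f =1 g.
Proof.
move=> e.
pose phi i : {additive mor c (x i) -> V} := g \o postcomp (inj i).
have [h [_ Hh]] := cc cop phi.
by move=> u; rewrite (Hh f) ?(Hh g).
Qed.

Let piece := {i : I & mor c (x i)}.
Let Piece i (u : mor c (x i)) : piece := existT _ i u.

(** Sum in [mor c s] of finitely many morphisms given in components. *)
Definition finsum (l : seq piece) : mor c s :=
  \sum_(t <- l) (inj (tag t) ∘ tagged t).

(** Being such a sum; a boolean predicate by excluded middle, as the subtype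
    construction of groups requires. *)
Definition is_finsum : {pred mor c s} := fun f => `[< exists l, f = finsum l >].

Lemma is_finsum_zmod : zmod_closed is_finsum.
Proof.
split=> [|_ _ /asboolP[l ->] /asboolP[m ->]]; apply/asboolP.
  by exists [::]; rewrite /finsum big_nil.
exists (l ++ [seq Piece (- (tagged t : mor c (x (tag t)))) | t <- m]).
rewrite /finsum big_cat big_map /=; congr (_ + _).
by rewrite -sumrN; apply: eq_bigr => t _; rewrite compmN.
Qed.

HB.instance Definition _ := GRing.isZmodClosed.Build _ is_finsum is_finsum_zmod.

(** The group of finite sums inside [mor c s]. *)
Record finsum_group := FinsumGroup {
  finsum_val :> mor c s; finsum_valP : finsum_val \in is_finsum }.

HB.instance Definition _ := [isSub for finsum_val].
HB.instance Definition _ := [Choice of finsum_group by <:].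
HB.instance Definition _ := [SubChoice_isSubZmodule of finsum_group by <:].

Lemma finsum1 i (u : mor c (x i)) : inj i ∘ u \in is_finsum.
Proof.
by apply/asboolP; exists [:: Piece u]; rewrite /finsum big_seq1.
Qed.

Definition finsum_in i (u : mor c (x i)) := FinsumGroup (finsum1 u).

Lemma finsum_in_is_zmod_morphism i : zmod_morphism (@finsum_in i).
Proof. by move=> u v; apply: val_inj; rewrite raddfB /= compmB. Qed.

HB.instance Definition _ i :=
  GRing.isZmodMorphism.Build _ _ (@finsum_in i) (@finsum_in_is_zmod_morphism i).

(** A morphism from a compact object to a coproduct is a finite sum of
    morphisms to the summands: the finite sums satisfy the universal property
    that characterises all morphisms. *)
Lemma compact_finsum (f : mor c s) : exists l, f = finsum l.
Proof.
have [psi [Hpsi _]] :=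
  cc cop (fun i => (@finsum_in i : {additive _ -> finsum_group})).
have e := @compact_ext _ (val \o psi) idfun.
have -> : f = val (psi f) by apply/esym/e => i u /=; rewrite Hpsi.
exact/asboolP/finsum_valP.
Qed.

End Coproduct.

Section FiniteSupport.
Variables (I : eqType) (x : I -> C) (s : C) (inj : forall i, mor (x i) s).
Hypothesis cop : is_coproduct inj.
Variable p : forall i, mor s (x i).
Hypothesis p_id : forall i, p i ∘ inj i = idm (x i).
Hypothesis p_ne : forall i j, i <> j -> p i ∘ inj j = 0.
Variables (c : C) (cc : compact c).

Lemma compact_finite_support (f : mor c s) :
  exists r : seq I, forall i, i \notin r -> p i ∘ f = 0.
Proof.
have [l ->] := compact_finsum cop cc f; exists (map tag l) => i il.
rewrite /finsum comp_sumr big_seq big1 // => t tl; rewrite mcompA p_ne ?comp0m //.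
by move=> e; case/negP: il; rewrite e; apply/mapP; exists t.
Qed.

(** A morphism from a compact object to a coproduct is determined by its
    components. *)
Lemma compact_proj_inj (f : mor c s) : (forall i, p i ∘ f = 0) -> f = 0.
Proof.
have [l ef] := compact_finsum cop cc f => f0.
pose r := undup (map tag l).
have -> : f = \sum_(i <- r) (inj i ∘ p i ∘ f).
  rewrite ef {1}/finsum.
  under [RHS]eq_bigr do rewrite /finsum comp_sumr.
  rewrite exchange_big /= big_seq [RHS]big_seq; apply: eq_bigr => t tl.
  rewrite (bigD1_seq (tag t)) ?undup_uniq ?mem_undup ?map_f //=.
  rewrite big1 => [|i /eqP it].
    by rewrite addr0 -!mcompA (mcompA (p _)) p_id comp1m.
  by rewrite -!mcompA (mcompA (p _)) p_ne // comp0m compm0.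
by rewrite big1 // => i _; rewrite -mcompA f0 compm0.
Qed.

End FiniteSupport.
End PreadditiveLemmas.

(** ** Transport of compactness *)

(** [G] maps every coproduct cocone to a coproduct cocone. *)
Definition preserves_coproducts (C D : preadditive) (G : functor C D) :=
  forall (I : small) (x : I -> C) (s : C) (inj : forall i, mor (x i) s),
    is_coproduct inj -> is_coproduct (fun i => fmap G (inj i)).

(** If [c'] corepresents [Hom(c, G -)] for a coproduct-preserving [G] and a
    compact [c], then [c'] is compact. *)
Section Corepresentation.
Variables (C D : preadditive) (G : functor C D) (c : D) (c' : C).
Variable eta : mor c (G c').

(** The map [Hom(c', y) -> Hom(c, G y)] given by the universal element [eta]. *)
Definition corep (y : C) (f : mor c' y) : mor c (G y) := fmap G f ∘ eta.

Lemma corep_is_zmod_morphism y : zmod_morphism (@corep y).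
Proof.
by move=> f g; rewrite /corep fmapD fmapN compBm.
Qed.

HB.instance Definition _ y :=
  GRing.isZmodMorphism.Build _ _ (@corep y) (@corep_is_zmod_morphism y).

Variable corepV : forall y, mor c (G y) -> mor c' y.
Arguments corepV : clear implicits.
Hypothesis corepK : forall y, cancel (@corep y) (corepV y).
Hypothesis corepVK : forall y, cancel (corepV y) (@corep y).

Lemma corepV_is_zmod_morphism y : zmod_morphism (corepV y).
Proof. exact: (can2_zmod_morphism (@corepK y) (@corepVK y)). Qed.

HB.instance Definition _ y :=
  GRing.isZmodMorphism.Build _ _ (corepV y) (@corepV_is_zmod_morphism y).

Lemma compact_corepV : preserves_coproducts G -> compact c -> compact c'.
Proof.
move=> HG cc I x s inj cop V phi.
have [psi [Hpsi Upsi]] := cc _ _ _ _ (HG _ _ _ _ cop) V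
  (fun i => phi i \o corepV (x i)).
have corepD i f : corep (inj i ∘ f) = fmap G (inj i) ∘ corep f.
  by rewrite /corep fmap_comp mcompA.
exists (psi \o @corep s); split=> [i f | psi' Hpsi' f] /=.
  by rewrite corepD Hpsi /= corepK.
rewrite -(Upsi (psi' \o corepV s)) /= ?corepK // => i g.
by rewrite -[g]corepVK -corepD /= corepK Hpsi' corepK.
Qed.

End Corepresentation.

Lemma compact_corep (C D : preadditive) (G : functor C D) (c : D) (c' : C)
    (eta : mor c (G c')) :
  (forall y, bijective (fun f : mor c' y => fmap G f ∘ eta)) ->
  preserves_coproducts G -> compact c -> compact c'.
Proof.
move=> bij.
have H y : exists g : mor c (G y) -> mor c' y, [/\ cancel (corep eta (y := y)) g
    & cancel g (corep eta (y := y))] by have [g] := bij y; exists g.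
pose g y := projT1 (cid (H y)).
have K y : cancel (corep eta (y := y)) (g y) by rewrite /g; case: cid => ? [].
have VK y : cancel (g y) (corep eta (y := y)) by rewrite /g; case: cid => ? [].
exact: (compact_corepV K VK).
Qed.

Lemma compact_iso (C : preadditive) (c c' : C) :
  isomorphic c c' -> compact c -> compact c'.
Proof.
case=> u [v [vu uv]]; apply: (compact_corep (G := functor_id C) (eta := u)) => //.
move=> y; exists (fun f => f ∘ v) => f /=; rewrite -mcompA.
  by rewrite uv compm1.
by rewrite vu compm1.
Qed.

Section EquivalenceCompact.
Variables (C : preadditive) (F G : functor C C).
Variables (GF : nat_iso (functor_comp G F) (functor_id C)).
Variables (FG : nat_iso (functor_comp F G) (functor_id C)).

Lemma preserves_coproducts_equiv : preserves_coproducts F.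
Proof.
move=> I x s inj cop y f.
have [a [b [ba ab]]] : isomorphic (F (G y)) y := isomorphic_niso FG y.
pose H i := cid (fmap_equiv_full GF FG (b ∘ f i)).
have [g Hg] := coproduct_ex cop (fun i => projT1 (H i)).
exists (a ∘ fmap F g); split=> [i|g' Hg'].
  by rewrite -mcompA -fmap_comp Hg -(projT2 (H i)) mcompA ab comp1m.
have [k ek] := fmap_equiv_full GF FG (b ∘ g').
suff -> : g = k by rewrite -ek mcompA ab comp1m.
apply: (coproduct_ext cop) => i; apply: (fmap_equiv_inj GF).
by rewrite Hg -(projT2 (H i)) fmap_comp -ek -mcompA Hg'.
Qed.

Lemma compact_equiv c : compact c -> compact (G c).
Proof.
have [a [b [ba ab]]] : isomorphic (F (G c)) c := isomorphic_niso FG c.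
apply: (compact_corep (eta := b) _ preserves_coproducts_equiv) => y.
pose H (f : mor c (F y)) := cid (fmap_equiv_full GF FG (f ∘ a)).
exists (fun f => projT1 (H f)) => f.
  apply: (fmap_equiv_inj GF); rewrite -(projT2 (H _)).
  by rewrite -mcompA ba compm1.
by rewrite -(projT2 (H _)) -mcompA ab compm1.
Qed.

End EquivalenceCompact.

(** * Triangulated categories *)

Section Triangles.
Variable T : triangulated.
Implicit Types x y z c s w : T.

Lemma fmap_susp_eq0 x y (f : mor x y) : fmap susp f = 0 -> f = 0.
Proof.
by move=> f0; apply: (fmap_equiv_inj suspK); rewrite fmap0.
Qed.

Lemma fmap_susp_full x y (f : mor (susp x) (susp y)) :
  exists g, f = fmap susp g.
Proof. exact: (fmap_equiv_full suspK desuspK). Qed.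

Lemma susp_desusp x : isomorphic (susp (desusp x)) x.
Proof. exact: (isomorphic_niso desuspK). Qed.

Lemma desusp_susp x : isomorphic (desusp (susp x)) x.
Proof. exact: (isomorphic_niso suspK). Qed.

Lemma susp_shift n x : isomorphic (susp (shift T n x)) (shift T (n + 1) x).
Proof.
case: n => [n|[|n]].
- have -> : Posz n + 1 = Posz n.+1 by rewrite -addn1 PoszD.
  exact: isomorphic_refl.
- exact: susp_desusp.
- have -> : Negz n.+1 + 1 = Negz n by rewrite !NegzE -addn1 PoszD opprD addrNK.
  exact: susp_desusp.
Qed.

Section Triangle.
Variables (x y z : T) (f : mor x y) (g : mor y z) (h : mor z (susp x)).
Hypothesis d : distinguished f g h.

Lemma distinguished_comp0 : g ∘ f = 0.
Proof.
have [o oo] := has_zero T.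
have [|k [e _]] := @tr_map T _ _ _ _ _ _ _ _ _ _ _ _ (idm x) f (tr_id x oo) d.
  by [].
by rewrite -e compm0.
Qed.

Lemma distinguished_exact_l : hom_exact f g.
Proof.
move=> c u gu0; have /tr_rotate/tr_rotate/distinguished_exact ex := d.
have [|v] := ex _ (fmap susp u).
  by rewrite compNm -fmap_comp gu0 fmap0 oppr0.
have [w ->] := fmap_susp_full v; rewrite compNm -compmN => e.
by exists (- w); apply: (fmap_equiv_inj suspK); rewrite e fmap_comp fmapN.
Qed.

Lemma distinguished_factor w (u : mor y w) :
  u ∘ f = 0 -> exists v : mor z w, u = v ∘ g.
Proof.
move=> uf0; have [o oo] := has_zero T.
have oo' : is_zero (susp o).
  apply: hom_trivial_id => k; have [k' ->] := fmap_susp_full k.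
  by rewrite (oo.1 _ k') fmap0.
have dw : distinguished (0 : mor o w) (idm w) (0 : mor w (susp o)).
  apply/tr_rotate; rewrite fmap0 oppr0; exact: tr_id.
have [|v [e _]] := tr_map (a := (0 : mor x o)) (b := u) d dw.
  by rewrite uf0 comp0m.
by exists v; rewrite e comp1m.
Qed.

End Triangle.

(** Orthogonality of a cone from the five lemma: [Hom(s, f)] is onto and
    [Hom(desusp s, f)] is injective. *)
Lemma cone_orthogonal s x y z (f : mor x y) (g : mor y z) (h : mor z (susp x)) :
    distinguished f g h ->
    (forall v : mor s y, exists u, v = f ∘ u) ->
    (forall u : mor (desusp s) x, f ∘ u = 0 -> u = 0) ->
  hom_trivial s z.
Proof.
move=> d surj inj k.
have hk0 : h ∘ k = 0.
  have [a [b [ba ab]]] := susp_desusp s.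
  have [u eu] := fmap_susp_full (h ∘ k ∘ a).
  suff u0 : u = 0 by rewrite -(compm1 (h ∘ k)) -ab mcompA eu u0 fmap0 comp0m.
  apply/inj/fmap_susp_eq0; rewrite fmap_comp -eu.
  have /tr_rotate/tr_rotate/distinguished_comp0 := d.
  by rewrite compNm !mcompA => /eqP; rewrite oppr_eq0 => /eqP ->; rewrite !comp0m.
have [v ->] := distinguished_exact d hk0.
by have [u ->] := surj v; rewrite mcompA (distinguished_comp0 d) comp0m.
Qed.

(** ** Finiteness of graded Hom groups *)

Lemma finitely_many_homs_isol x x' y :
  isomorphic x x' -> finitely_many_homs x y -> finitely_many_homs x' y.
Proof. by move=> i [r Hr]; exists r => n /Hr; exact: hom_trivial_isol. Qed.

Lemma finitely_many_homs_suspl x y :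
  finitely_many_homs x y -> finitely_many_homs (susp x) y.
Proof.
case=> r Hr; exists (map (fun n => n + 1) r) => n nr.
have H : hom_trivial x (shift T (n - 1) y).
  by apply: Hr; apply: contra nr => nr; apply/mapP; exists (n - 1); rewrite ?subrK.
have := susp_shift (n - 1) y; rewrite subrK => i; apply: (hom_trivial_iso i) => f.
by have [g ->] := fmap_susp_full f; rewrite (H g) fmap0.
Qed.

Section TwoOfThree.
Variables (x y z w : T) (f : mor x y) (g : mor y z) (h : mor z (susp x)).
Hypothesis d : distinguished f g h.

Lemma finitely_many_homs_middle :
  finitely_many_homs x w -> finitely_many_homs z w -> finitely_many_homs y w.
Proof.
case=> [r Hr] [q Hq]; exists (r ++ q) => n; rewrite mem_cat negb_or.
case/andP=> nr nq u; have [|v ->] := distinguished_factor d (u := u).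
  exact: Hr.
by rewrite (Hq _ nq v) comp0m.
Qed.

End TwoOfThree.

Lemma finitely_many_homs_cone x y z w (f : mor x y) (g : mor y z)
    (h : mor z (susp x)) : distinguished f g h ->
  finitely_many_homs x w -> finitely_many_homs y w -> finitely_many_homs z w.
Proof.
move=> /tr_rotate d xw yw.
exact: (finitely_many_homs_middle d yw (finitely_many_homs_suspl xw)).
Qed.

End Triangles.

Lemma compact_susp (T : triangulated) (c : T) : compact c -> compact (susp c).
Proof. exact: (compact_equiv desuspK suspK). Qed.

Lemma compact_desusp (T : triangulated) (c : T) : compact c -> compact (desusp c).
Proof. exact: (compact_equiv suspK desuspK). Qed.

(** * Boundedness is detected on a generating set of compact objects *)

Section Generators.
Variable T : triangulated.
Hypothesis copT : has_coproducts T.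
Variable S : T -> Prop.
Hypothesis S_compact : forall s, S s -> compact s.
Hypothesis S_iso : forall s s', isomorphic s s' -> S s -> S s'.
Hypothesis S_susp : forall s, S s -> S (susp s).
Hypothesis S_desusp : forall s, S s -> S (desusp s).
Hypothesis S_small : skeletally_small S.
Hypothesis S_gen : forall y, (forall s, S s -> hom_trivial s y) -> is_zero y.

(** Morphisms that vanish on all morphisms from the generators. *)
Definition ghost (y y' : T) (g : mor y y') :=
  forall s, S s -> forall f : mor s y, g ∘ f = 0.

(** [D] is a coproduct of a small family of generators. *)
Definition sum_of_generators (D : T) :=
  exists (J : small) (k : J -> T) (inj : forall j, mor (k j) D),
    is_coproduct inj /\ forall j, S (k j).

(** Killing all morphisms from the generators to [y]: the cone of the
    evaluation map from a coproduct of generators. *)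
Lemma ghost_step (y : T) : exists t : {y' : T & mor y y'},
  ghost (tagged t) /\ exists (D : T) (d : mor D y) (h : mor (tag t) (susp D)),
    sum_of_generators D /\ distinguished d (tagged t) h.
Proof.
have [J [k Hk]] := S_small.
(* One summand for each morphism to y from a representative of a generator. *)
pose J' : small := {j : {j : J | S (k j)} & mor (k (sval j)) y}.
have [D [inj cop]] := copT (fun j : J' => k (sval (projT1 j))).
have [d Hd] := coproduct_ex cop (fun j : J' => projT2 j).
have [y' [g [h dgh]]] := tr_cone d.
exists (existT _ y' g); split=> /= [s Ss f|].
  have [j [a [b [ba ab]]]] := Hk s Ss.
  have Sj : S (k j) := S_iso (ex_intro _ a (ex_intro _ b (conj ba ab))) Ss.
  pose j' : J' := existT _ (exist _ j Sj) (f ∘ b).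
  have e : f ∘ b = d ∘ inj j' by rewrite Hd.
  rewrite -(compm1 f) -ba (mcompA f) e -(mcompA d) mcompA.
  by rewrite (distinguished_comp0 dgh) comp0m.
exists D, d, h; split=> //; exists J', (fun j => k (sval (projT1 j))), inj.
by split=> // -[[j Sj] f].
Qed.

(** A sequence of ghosts composes to zero on a compact object after finitely
    many steps. Let [sh] be the endomorphism of the coproduct of the [y k]
    that maps each summand to the next one by [g]. Then [id - sh] is the identity
    on [Hom(s, -)] for every generator [s], so its cone vanishes; hence [t 0],
    followed by the inclusion, lifts through [id - sh], and the components
    of the lift are the composites of the sequence. *)
Lemma ghost_telescope (y : nat -> T) (g : forall k, mor (y k) (y k.+1)) (c : T)
    (t : forall k, mor c (y k)) :
  (forall k, ghost (g k)) -> compact c -> (forall k, t k.+1 = g k ∘ t k) ->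
  exists k, t k = 0.
Proof.
move=> gg cc tS; have [A [inj cop]] := copT y.
have [p [p_id p_ne]] := coproduct_proj cop.
have [sh Hsh] := coproduct_ex cop (fun k => inj k.+1 ∘ g k).
have sh0 s (f : mor s A) : S s -> sh ∘ f = 0.
  move=> Ss.
  have e : postcomp sh (x := s) =1 postcomp (0 : mor A A) (x := s).
    apply: (compact_ext cop (S_compact Ss)) => i u.
    by rewrite /= /postcomp mcompA Hsh -mcompA gg // compm0 comp0m.
  by rewrite -[LHS]/(postcomp sh f) e /postcomp comp0m.
pose phi := idm A - sh; have [Z [q [r d]]] := tr_cone phi.
have phi1 s (f : mor s A) : S s -> phi ∘ f = f.
  by move=> Ss; rewrite compBm sh0 // comp1m subr0.
have Z0 : is_zero Z.
  apply: S_gen => s Ss; apply: (cone_orthogonal d) => [v|u].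
    by exists v; rewrite phi1.
  by rewrite phi1 //; exact: S_desusp.
have [h eh] : exists h, inj 0%N ∘ t 0%N = phi ∘ h.
  exact/(distinguished_exact_l d)/Z0.2.
have sh_p0 : p 0%N ∘ sh = 0.
  apply: (coproduct_ext cop) => i.
  by rewrite -mcompA Hsh mcompA p_ne // !comp0m.
have sh_pS k : p k.+1 ∘ sh = g k ∘ p k.
  apply: (coproduct_ext cop) => i; rewrite -!mcompA Hsh mcompA.
  have [->|/eqP ik] := eqVneq k i; first by rewrite !p_id comp1m compm1.
  by rewrite !p_ne ?comp0m ?compm0 // => -[].
have ph k : p k ∘ h = t k.
  elim: k => [|k IH].
    have : p 0%N ∘ (phi ∘ h) = t 0%N by rewrite -eh mcompA p_id comp1m.
    by rewrite mcompA compmB sh_p0 compm1 subr0.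
  have : p k.+1 ∘ (phi ∘ h) = 0 by rewrite -eh mcompA p_ne // comp0m.
  rewrite mcompA compmB sh_pS compm1 compBm -mcompA IH -tS.
  by move/eqP; rewrite subr_eq0 => /eqP.
have [r' Hr] := compact_finite_support cop p_ne cc h.
exists (\max_(i <- r') i).+1; rewrite -ph; apply: Hr.
apply/negP => Kr.
by have := @leq_bigmax_seq _ _ xpredT (fun i : nat => i) _ Kr isT; rewrite ltnn.
Qed.

Section Detection.
Variable x : T.
Hypothesis S_fmh : forall s, S s -> finitely_many_homs s x.

Variables (W : T) (inj : forall n : int, mor (shift T n x) W).
Hypothesis cop : is_coproduct inj.
Variable p : forall n, mor W (shift T n x).
Hypothesis p_id : forall n, p n ∘ inj n = idm _.
Hypothesis p_ne : forall m n, m <> n -> p m ∘ inj n = 0.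

(** Maps into all the shifts of [x] assemble to a map into their coproduct, as
    if it were a product. *)
Definition product_lift (z : T) :=
  forall f : forall n, mor z (shift T n x), exists F, forall n, p n ∘ F = f n.

Lemma product_lift_generator s : S s -> product_lift s.
Proof.
move=> Ss f; have [r Hr] := S_fmh Ss.
exists (\sum_(n <- undup r) (inj n ∘ f n)) => n; rewrite comp_sumr.
have [nr|nr] := boolP (n \in r); last first.
  rewrite (Hr n nr (f n)) big_seq big1 // => m.
  rewrite mem_undup => mr; rewrite mcompA p_ne ?comp0m // => e.
  by rewrite e mr in nr.
rewrite (bigD1_seq n) ?undup_uniq ?mem_undup //= mcompA p_id comp1m.
by rewrite big1 ?addr0 // => m /eqP/nesym mn; rewrite mcompA p_ne // comp0m.
Qed.

Lemma product_lift_susp_sum D : sum_of_generators D -> product_lift (susp D).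
Proof.
case=> J [k [i [copD Sk]]] f.
have copsD := preserves_coproducts_equiv suspK desuspK copD.
pose H j := cid (product_lift_generator (S_susp (Sk j))
  (fun n => f n ∘ fmap susp (i j))).
have [F HF] := coproduct_ex copsD (fun j => projT1 (H j)).
exists F => n; apply: (coproduct_ext copsD) => j.
by rewrite -mcompA HF (projT2 (H j)).
Qed.

Lemma sum_proj_inj D (f : mor D W) :
  sum_of_generators D -> (forall n, p n ∘ f = 0) -> f = 0.
Proof.
case=> J [k [i [copD Sk]]] f0; apply: (coproduct_ext copD) => j.
rewrite comp0m; apply: (compact_proj_inj cop p_id p_ne (S_compact (Sk j))) => n.
by rewrite mcompA f0 comp0m.
Qed.

(** The four lemma for an extension of [susp D] by [u]: lifts exist for [u] and
    for [susp D], and lifts from [D] are unique. *)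
Lemma product_lift_extension u v D (f : mor u v) (g : mor v (susp D))
    (h : mor (susp D) (susp u)) :
  distinguished f g h -> sum_of_generators D ->
  product_lift u -> product_lift v.
Proof.
move=> d SD lu b; have [F HF] := lu (fun n => b n ∘ f).
have [h' eh] := fmap_susp_full h.
have Fh0 : F ∘ h' = 0.
  apply: (sum_proj_inj SD) => n; rewrite mcompA HF -mcompA.
  suff -> : f ∘ h' = 0 by rewrite compm0.
  apply: fmap_susp_eq0; rewrite fmap_comp -eh.
  have /tr_rotate/tr_rotate/distinguished_comp0 := d.
  by rewrite compNm => /eqP; rewrite oppr_eq0 => /eqP.
have [F' eF] : exists F', F = F' ∘ f.
  have /tr_rotate/tr_rotate d' := d.
  have [|w] := distinguished_factor d' (u := fmap susp F).
    by rewrite eh -fmap_comp Fh0 fmap0.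
  have [w' ->] := fmap_susp_full w.
  rewrite compmN -compNm => e; exists (- w').
  by apply: (fmap_equiv_inj suspK); rewrite e fmap_comp fmapN.
have H n : exists k : mor (susp D) (shift T n x), b n - p n ∘ F' = k ∘ g.
  by apply: (distinguished_factor d); rewrite compBm -mcompA -eF HF subrr.
have [K HK] := product_lift_susp_sum SD (fun n => projT1 (cid (H n))).
exists (F' + K ∘ g) => n; rewrite compDr mcompA HK -(projT2 (cid (H n))).
by rewrite addrC subrK.
Qed.

(** The lifting property passes to the cones of the composites of the ghost
    sequence that starts at [c]. *)
Lemma product_lift_compact c : compact c -> product_lift (susp c).
Proof.
move=> cc; pose N y := projT1 (cid (ghost_step y)).
have gN y : ghost (tagged (N y)) := proj1 (projT2 (cid (ghost_step y))).
have dN y := proj2 (projT2 (cid (ghost_step y))).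
pose Y := fix Y k := if k is k'.+1 then tag (N (Y k')) else c.
pose t := fix t k : mor c (Y k) :=
  if k is k'.+1 then tagged (N (Y k')) ∘ t k' else idm c.
have [K tK] := ghost_telescope (t := t) (fun k => gN (Y k)) cc (fun k => erefl).
have [u [a [b [d lu]]]] : exists u (a : mor (Y K) u) (b : mor u (susp c)),
    distinguished (t K) a b /\ product_lift u.
  elim: K {tK} => [|k [u [a [b [d lu]]]]].
    have [o oo] := has_zero T; exists o, 0, 0; split; first exact: tr_id.
    by move=> f; exists 0 => n; rewrite compm0 (oo.1 _ (f n)).
  have [D [e [h [SD de]]]] := dN (Y k).
  (* The octahedron on the factorisation of t k.+1 through t k makes the cone
     of t k.+1 an extension of susp D by the cone of t k. *)
  have [u' [a' [b' d']]] := tr_cone (t k.+1).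
  exists u', a', b'; split=> //; have /tr_rotate de' := de.
  have [f [g [df _ _ _ _]]] := tr_octahedron d de' d'.
  exact: (product_lift_extension df SD).
(* As t K = 0, susp c is a retract of the cone of t K. *)
have [|v bv] := distinguished_exact (proj1 (tr_rotate _ _ _) d) (u := idm (susp c)).
  by rewrite tK fmap0 oppr0 comp0m.
move=> f; have [F HF] := lu (fun n => f n ∘ b).
by exists (F ∘ v) => n; rewrite mcompA HF -mcompA -bv compm1.
Qed.

Lemma finitely_many_homs_susp_compact c :
  compact c -> finitely_many_homs (susp c) x.
Proof.
move=> cc.
have H n : exists f : mor (susp c) (shift T n x),
    f = 0 -> hom_trivial (susp c) (shift T n x).
  have [h0|h0] := pselect (hom_trivial (susp c) (shift T n x)); first by exists 0.
  have [f f0] : exists f : mor (susp c) (shift T n x), f <> 0 by exact/existsNP.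
  by exists f.
have [F HF] := product_lift_compact cc (fun n => projT1 (cid (H n))).
have [r Hr] := compact_finite_support cop p_ne (compact_susp cc) F.
exists r => n nr; apply: (projT2 (cid (H n))).
by rewrite -HF Hr.
Qed.

End Detection.

(** An object with finitely many nonzero graded maps from every generator is
    bounded. *)
Theorem bounded_generators x :
  (forall s, S s -> finitely_many_homs s x) -> bounded x.
Proof.
move=> Sx c cc; have [W [inj cop]] := copT (fun n : int => shift T n x).
have [p [p_id p_ne]] := coproduct_proj cop.
apply: (finitely_many_homs_isol (susp_desusp c)).
exact: (finitely_many_homs_susp_compact Sx cop p_id p_ne (compact_desusp cc)).
Qed.

End Generators.

(** * Triangle functors and adjunctions *)

Section TriangleFunctors.
Variables (S T : triangulated) (F : triangle_functor S T).

Lemma tfunctor_susp_iso x : isomorphic (F (susp x)) (susp (F x)).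
Proof. exact: (isomorphic_niso (tfunctor_susp F)). Qed.

Lemma tfunctor_desusp_iso x : isomorphic (F (desusp x)) (desusp (F x)).
Proof.
apply: isomorphic_trans (isomorphic_sym (desusp_susp _)) _.
apply: isomorphic_functor.
apply: isomorphic_trans (isomorphic_sym (tfunctor_susp_iso _)) _.
exact/isomorphic_functor/susp_desusp.
Qed.

Lemma tfunctor_shift n x : isomorphic (F (shift S n x)) (shift T n (F x)).
Proof.
case: n => n.
  elim: n => [|n IH]; first exact: isomorphic_refl.
  exact: isomorphic_trans (tfunctor_susp_iso _) (isomorphic_functor susp IH).
elim: n => [|n IH]; first exact: tfunctor_desusp_iso.
exact: isomorphic_trans (tfunctor_desusp_iso _) (isomorphic_functor desusp IH).
Qed.

Hypothesis ff : fully_faithful F.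

Lemma ff_faithful x y (f g : mor x y) : fmap F f = fmap F g -> f = g.
Proof. by have [h hK _] := ff x y => /(congr1 h); rewrite !hK. Qed.

Lemma ff_full x y (f : mor (F x) (F y)) : exists g, f = fmap F g.
Proof. by have [h _ Kh] := ff x y; exists (h f); rewrite Kh. Qed.

Lemma ff_hom_trivial x y : hom_trivial (F x) (F y) <-> hom_trivial x y.
Proof.
split=> H f; last by have [g ->] := ff_full f; rewrite (H g) fmap0.
by apply: ff_faithful; rewrite (H (fmap F f)) fmap0.
Qed.

Lemma ff_finitely_many_homs x y :
  finitely_many_homs (F x) (F y) <-> finitely_many_homs x y.
Proof.
split=> -[r Hr]; exists r => n /Hr H.
  exact/ff_hom_trivial/(hom_trivial_iso (isomorphic_sym (tfunctor_shift n y))).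
exact/(hom_trivial_iso (tfunctor_shift n y))/ff_hom_trivial.
Qed.

Lemma ff_is_zero x : is_zero (F x) -> is_zero x.
Proof. by move=> F0; apply/hom_trivial_id/ff_hom_trivial/F0.1. Qed.

End TriangleFunctors.

Section Adjunctions.
Variables (C D : preadditive) (F : functor C D) (G : functor D C).
Variable a : adjunction F G.

Lemma adjl x y y' (v : mor y y') (f : mor (F x) y) :
  adj a (v ∘ f) = fmap G v ∘ adj a f.
Proof. by have := adj_natural a (idm x) v f; rewrite fmap1 !compm1. Qed.

Lemma adjr x x' y (u : mor x' x) (f : mor (F x) y) :
  adj a (f ∘ fmap F u) = adj a f ∘ u.
Proof. by have := adj_natural a u (idm y) f; rewrite fmap1 !comp1m. Qed.

Lemma adjE x y (f : mor (F x) y) : adj a f = fmap G f ∘ adj a (idm (F x)).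
Proof. by rewrite -adjl compm1. Qed.

Lemma adj0 x y : adj a (0 : mor (F x) y) = 0.
Proof. by rewrite adjE fmap0 comp0m. Qed.

Lemma adj_inj x y : injective (@adj _ _ _ _ a x y).
Proof. exact/bij_inj/adj_bij. Qed.

Lemma adj_surj x y (g : mor x (G y)) : exists f, g = adj a f.
Proof. by have [h _ K] := adj_bij a x y; exists (h g); rewrite K. Qed.

Lemma adj_hom_trivial x y : hom_trivial (F x) y <-> hom_trivial x (G y).
Proof.
split=> H f; first by have [g ->] := adj_surj f; rewrite (H g) adj0.
by apply: adj_inj; rewrite adj0.
Qed.

Lemma left_adjoint_preserves_coproducts : preserves_coproducts F.
Proof.
move=> I x s inj cop y f.
have [g Hg] := coproduct_ex cop (fun i => adj a (f i)).
have [g' eg] := adj_surj g.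
exists g'; split=> [i | h Hh]; first by apply: adj_inj; rewrite adjr -eg Hg.
apply: adj_inj; rewrite -eg; apply: (coproduct_ext cop) => i.
by rewrite Hg -adjr Hh.
Qed.

Lemma left_adjoint_compact c :
  preserves_coproducts G -> compact c -> compact (F c).
Proof.
apply: (compact_corep (eta := adj a (idm (F c)))) => y.
by apply: (eq_bij (adj_bij a c y)) => f; exact: adjE.
Qed.

End Adjunctions.

Lemma adj_finitely_many_homs (S T : triangulated) (F : functor S T)
    (G : triangle_functor T S) (a : adjunction F G) x y :
  finitely_many_homs (F x) y <-> finitely_many_homs x (G y).
Proof.
split=> -[r Hr]; exists r => n /Hr H.
  by apply: (hom_trivial_iso (tfunctor_shift G n y)); apply/(adj_hom_trivial a).
apply/(adj_hom_trivial a).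
exact: (hom_trivial_iso (isomorphic_sym (tfunctor_shift G n y))).
Qed.

(** * Recollements *)

Section Recollement.
Variables (A B C : triangulated) (R : recollement A B C).
Let i := rec_i R. Let q := rec_q R. Let p := rec_p R.
Let e := rec_e R. Let l := rec_l R.
Let qi := rec_adj_qi R. Let ip := rec_adj_ip R. Let le := rec_adj_le R.

Lemma rec_ei_zero (a : A) : is_zero (e (i a)).
Proof. by apply/(rec_ker_im R); exists a; exact: isomorphic_refl. Qed.

Lemma rec_li_trivial (c : C) (a : A) : hom_trivial (l c) (i a).
Proof. by apply/(adj_hom_trivial le)/(rec_ei_zero a).2. Qed.

(** The canonical triangle [l e b -> b -> i a]: the counit becomes invertible
    under [Hom(l c, -)], so its cone is killed by [e]. *)
Lemma rec_triangle (b : B) : exists (a : A) (f : mor (l (e b)) b)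
  (g : mor b (i a)) (h : mor (i a) (susp (l (e b)))), distinguished f g h.
Proof.
have [f ef] := adj_surj le (idm (e b)).
have fl c (u : mor c (e b)) : adj le (f ∘ fmap l u) = u.
  by rewrite adjr -ef comp1m.
have inj c (u : mor (l c) (l (e b))) : f ∘ u = 0 -> u = 0.
  have [v ->] := ff_full (rec_l_ff R) u => fv0.
  by rewrite -(fl _ v) fv0 adj0 fmap0.
have [z [g [h d]]] := tr_cone f.
have /(rec_ker_im R)[a [v [w [wv vw]]]] : is_zero (e z).
  apply/hom_trivial_id/(adj_hom_trivial le)/(cone_orthogonal d) => [u|u fu0].
    by exists (fmap l (adj le u)); apply: (adj_inj (a := le)); rewrite fl.
  have [s [t [ts st]]] := tfunctor_desusp_iso l (e z).
  by rewrite -(compm1 u) -st mcompA (inj _ (u ∘ s)) ?comp0m // mcompA fu0 comp0m.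
exists a, f, (w ∘ g), (h ∘ v).
apply: (tr_iso (a := idm _) (b := idm _) (c := w) _ _ _ _ _ _ d).
- by exists (idm _); rewrite comp1m.
- by exists (idm _); rewrite comp1m.
- by exists v.
- by rewrite comp1m compm1.
- by rewrite compm1.
- by rewrite fmap1 comp1m -mcompA vw compm1.
Qed.

Lemma rec_finitely_many_homs (b b' : B) (a : A) (f : mor (l (e b)) b)
    (g : mor b (i a)) (h : mor (i a) (susp (l (e b)))) :
  distinguished f g h -> finitely_many_homs (e b) (e b') ->
  finitely_many_homs a (p b') -> finitely_many_homs b b'.
Proof.
move=> d ebb' abb'; apply: (finitely_many_homs_middle d).
  exact/(adj_finitely_many_homs le).
exact/(adj_finitely_many_homs ip).
Qed.

(** In the canonical triangle, [a] corepresents [Hom(b, i -)], as [q b] does. *)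
Lemma rec_triangle_q (b : B) (a : A) (f : mor (l (e b)) b) (g : mor b (i a))
    (h : mor (i a) (susp (l (e b)))) :
  distinguished f g h -> isomorphic (q b) a.
Proof.
move=> d; have [g' eg] := adj_surj qi g.
have surj a' (u : mor (q b) a') : exists w, u = w ∘ g'.
  have [|k ek] := distinguished_factor d (u := adj qi u).
    exact: rec_li_trivial.
  have [w ew] := ff_full (rec_i_ff R) k; exists w.
  by apply: (adj_inj (a := qi)); rewrite adjl ek ew -eg.
have inj a' (w : mor a a') : w ∘ g' = 0 -> w = 0.
  move=> wg0; have : fmap i w ∘ g = 0 by rewrite eg -adjl wg0 adj0.
  move/(distinguished_factor (proj1 (tr_rotate _ _ _) d)) => [m em].
  have [s [t [ts st]]] := tfunctor_susp_iso l (e b).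
  have m0 : m = 0.
    by rewrite -(compm1 m) -st mcompA (rec_li_trivial (m ∘ s)) comp0m.
  by apply: (ff_faithful (rec_i_ff R)); rewrite em m0 comp0m fmap0.
have [w ew] := surj _ (idm (q b)); exists g', w; split=> //.
apply/eqP; rewrite -subr_eq0; apply/eqP/inj.
by rewrite compBm -mcompA -ew compm1 comp1m subrr.
Qed.

End Recollement.

(** Every two objects have only finitely many nonzero graded Hom groups. *)
Definition hom_finite (T : triangulated) := forall x y : T, finitely_many_homs x y.

Lemma recollement_hom_finite (A B C : triangulated) :
  recollement A B C -> hom_finite B <-> hom_finite A /\ hom_finite C.
Proof.
move=> R; split=> [H | [HA HC] b b'].
  split=> x y; first exact/(ff_finitely_many_homs (rec_i_ff R)).
  exact/(ff_finitely_many_homs (rec_l_ff R)).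
by have [a [f [g [h d]]]] := rec_triangle R b; exact: (rec_finitely_many_homs d).
Qed.

(** * Finite global dimension *)

Lemma sval_shift (T : triangulated) n (x : bounded_category T) :
  sval (shift (bounded_category T) n x) = shift T n (sval x).
Proof. by case: n => n; elim: n => //= n; rewrite /functor_pow /= => ->. Qed.

Lemma bounded_category_homs (T : triangulated) (x y : bounded_category T) :
  finitely_many_homs x y <-> finitely_many_homs (sval x) (sval y).
Proof.
by split=> -[r Hr]; exists r => n /Hr; rewrite /hom_trivial /= sval_shift.
Qed.

Lemma finite_gldim_hom_finite (T : triangulated) :
  (forall t : T, bounded_projective t -> bounded t) ->
  finite_gldim T <-> hom_finite (bounded_category T).
Proof.
move=> bT; split=> [fT x y | H t].
  by apply/bounded_category_homs/((fT _).2 (svalP x))/svalP.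
split=> [/bT // | bt x bx].
exact: (bounded_category_homs (exist _ t bt) (exist _ x bx)).1.
Qed.

Section RecollementBounded.
Variables (X T Y : triangulated) (R : recollement X T Y).
Let i := rec_i R. Let q := rec_q R. Let p := rec_p R.
Let e := rec_e R. Let l := rec_l R.
Let qi := rec_adj_qi R. Let ip := rec_adj_ip R. Let le := rec_adj_le R.
Let er := rec_adj_er R.

Lemma rec_q_compact c : compact c -> compact (q c).
Proof.
exact/(left_adjoint_compact qi)/(left_adjoint_preserves_coproducts ip).
Qed.

Lemma rec_l_compact c : compact c -> compact (l c).
Proof.
exact/(left_adjoint_compact le)/(left_adjoint_preserves_coproducts er).
Qed.

Lemma rec_e_bounded t : bounded t -> bounded (e t).
Proof.
by move=> bt c cc; apply/(adj_finitely_many_homs le)/bt/rec_l_compact.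
Qed.

(** The images under [q] of compact objects generate, hence detect boundedness. *)
Lemma rec_bounded_q (x : X) :
  compactly_generated X -> compactly_generated T ->
  (forall d, compact d -> finitely_many_homs (q d) x) -> bounded x.
Proof.
move=> [copX _ _] [_ [J [k Hk]] genT] Hx.
pose S s := exists2 d, compact d & isomorphic (q d) s.
apply: (@bounded_generators X copX S).
- by move=> s [d cd]; move/compact_iso; apply; exact: rec_q_compact.
- by move=> s s' ss' [d cd ds]; exists d => //; exact: isomorphic_trans ss'.
- move=> s [d cd ds]; exists (susp d); first exact: compact_susp.
  exact: isomorphic_trans (tfunctor_susp_iso q d) (isomorphic_functor susp ds).
- move=> s [d cd ds]; exists (desusp d); first exact: compact_desusp.
  exact: isomorphic_trans (tfunctor_desusp_iso q d) (isomorphic_functor desusp ds).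
- exists J, (fun j => q (k j)) => s [d /Hk[j dj] ds]; exists j.
  exact: isomorphic_trans (isomorphic_sym ds) (isomorphic_functor q dj).
- move=> y Hy; apply/(ff_is_zero (rec_i_ff R))/genT => d cd.
  by apply/(adj_hom_trivial qi)/Hy; exists d => //; exact: isomorphic_refl.
- by move=> s [d cd ds]; apply: finitely_many_homs_isol ds _; exact: Hx.
Qed.

Lemma recollement_finite_gldim :
  compactly_generated X -> compactly_generated T ->
  (forall t : T, bounded_projective t -> bounded t) ->
  finite_gldim X -> finite_gldim Y -> finite_gldim T.
Proof.
move=> cX cT bT fX fY t; split=> [/bT // | bt t' bt'].
have ehom u u' : bounded u -> bounded u' -> finitely_many_homs (e u) (e u').
  by move=> bu bu'; apply/((fY _).2 (rec_e_bounded bu))/rec_e_bounded.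
have bpt' : bounded (p t').
  apply: rec_bounded_q => // d cd.
  have bd : bounded d by apply: bT => x bx; exact: bx.
  have [a [f [g [h tri]]]] := rec_triangle R d.
  apply: (finitely_many_homs_isol (isomorphic_sym (rec_triangle_q tri))).
  apply/(adj_finitely_many_homs ip)/(finitely_many_homs_cone tri).
    exact/(adj_finitely_many_homs le)/ehom.
  exact: bt'.
have [a [f [g [h tri]]]] := rec_triangle R t.
have ba : bounded a.
  have ble : bounded (l (e t)).
    by apply: bT => x bx; apply/(adj_finitely_many_homs le)/ehom.
  have bia := sub_cone (@bounded_subcategory T) tri ble bt.
  by apply: rec_bounded_q => // d cd; apply/(adj_finitely_many_homs qi)/bia.
exact: (rec_finitely_many_homs tri (ehom _ _ bt bt') ((fX _).2 ba _ bpt')).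
Qed.

End RecollementBounded.

Theorem proposition6p10 (X Y T : triangulated)
  (hX : compactly_generated X)
  (hY : compactly_generated Y)
  (hT : compactly_generated T)
  (bX : forall t : X, bounded_projective t -> bounded t)
  (bY : forall t : Y, bounded_projective t -> bounded t)
  (bT : forall t : T, bounded_projective t -> bounded t) :
  (recollement (bounded_category X) (bounded_category T) (bounded_category Y) ->
   (finite_gldim T <-> finite_gldim X /\ finite_gldim Y)) /\
  (recollement X T Y -> finite_gldim X -> finite_gldim Y -> finite_gldim T).
Proof.
split=> R; last exact: (recollement_finite_gldim R).
rewrite !finite_gldim_hom_finite //; exact: recollement_hom_finite.
Qed.
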